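(* Each of the $14$ classes $T$ of edge-transitive maps contains $2^{\aleph_0}$ maps $\mathcal{M}$ with empty boundary and with mutually non-isomorphic automorphism groups $\mathrm{Aut}\,\mathcal{M}$.
   Context: Let $\Gamma=\langle R_0,R_1,R_2\mid R_i^2=(R_0R_2)^2=1\rangle$ and $E=\langle R_0,R_2\rangle\cong V_4$. A (connected) map $\mathcal{M}$ (possibly non-orientable, non-compact, or with non-empty boundary) is identified, up to isomorphism, with a transitive permutation representation of $\Gamma$ on a set $\Phi$ of flags, or equivalently with a conjugacy class of subgroups $M\le\Gamma$ (its map subgroups, the stabilisers of flags). Its vertices, edges and faces are the orbits on $\Phi$ of $\langle R_1,R_2\rangle$, $\langle R_0,R_2\rangle$ and $\langle R_0,R_1\rangle$. Its automorphism group $\mathrm{Aut}\,\mathcal{M}$ is the centraliser of $\Gamma$ in $\mathrm{Sym}\,\Phi$; it is isomorphic to $N_\Gamma(M)/M$. The map is edge-transitive if $\mathrm{Aut}\,\mathcal{M}$ is transitive on edges, equivalently $\Gamma=N_\Gamma(M)E$. There are $14$ conjugacy classes of subgroups $N\le\Gamma$ with $\Gamma=NE$, represented by the following subgroups $N(T)$. $N(1)=\Gamma$. Those of index $2$ are determined by which generators $R_i$ they contain: $N(2)$ contains exactly $R_1,R_2$; $N(2^* )$ exactly $R_0,R_1$; $N(2^P)$ exactly $R_1$; $N(2\,\mathrm{ex})$ exactly $R_2$; $N(2^*\mathrm{ex})$ exactly $R_0$; $N(2^P\mathrm{ex})$ none of them. Those of index $4$ are point stabilisers (defined up to conjugacy)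 in the actions of $\Gamma$ on $\{1,2,3,4\}$ with $R_0\mapsto(12)(34)$, $R_2\mapsto(14)(23)$ and $R_1\mapsto$: identity for $T=3$; $(14)$ for $T=4$; $(12)$ for $T=4^*$; $(13)$ for $T=4^P$; $(14)(23)$ for $T=5$; $(12)(34)$ for $T=5^*$; $(13)(24)$ for $T=5^P$. An edge-transitive map $\mathcal{M}$ is in class $T$ if $N_\Gamma(M)$ is conjugate to $N(T)$. A map has non-empty boundary if and only if some $R_i$ $(i=0,1,2)$ fixes a flag, equivalently $M$ contains a conjugate of some $R_i$; otherwise its boundary is empty. *)

(* Defs.v *)
From HB Require Import structures.
From mathcomp Require Import all_boot monoid perm.
From mathcomp Require Import boolp classical_sets.

Set Implicit Arguments.
Unset Strict Implicit.
Unset Printing Implicit Defensive.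

Local Open Scope classical_set_scope.
Local Open Scope group_scope.

Section Subgroups.
Variable G : groupType.
Implicit Types H K : set G.

Definition is_subgroup H :=
  H 1 /\ forall x y, H x -> H y -> H (x * y^-1).

Definition generated (A : set G) : set G := smallest is_subgroup A.

Definition conjugate_set H (g : G) : set G := [set h ^ g | h in H].

Definition conjugate H K := exists g, conjugate_set H g = K.

Definition normaliser H : set G := [set g | conjugate_set H g = H].

End Subgroups.

Definition isomorphic_groups (G H : groupType) :=
  exists f : {multiplicative G -> H}, bijective f.

(* The group Gamma = < R_0, R_1, R_2 | R_i^2 = (R_0 R_2)^2 = 1 >.  As each
   generator is an involution no formal inverses are needed: Gamma is the
   quotient of the free monoid on 'I_3 by the congruence generated by the
   relators, the inverse of a word being its reversal. *)

Definition word := seq 'I_3.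

Definition i0 : 'I_3 := @Ordinal 3 0 isT.
Definition i1 : 'I_3 := @Ordinal 3 1 isT.
Definition i2 : 'I_3 := @Ordinal 3 2 isT.

Inductive gamma_eq : word -> word -> Prop :=
| gamma_refl u : gamma_eq u u
| gamma_sym u v : gamma_eq u v -> gamma_eq v u
| gamma_trans v u w : gamma_eq u v -> gamma_eq v w -> gamma_eq u w
| gamma_cat u u' v v' :
    gamma_eq u u' -> gamma_eq v v' -> gamma_eq (u ++ v) (u' ++ v')
| gamma_sqr i : gamma_eq [:: i; i] [::]
| gamma_02 : gamma_eq [:: i0; i2; i0; i2] [::].

Definition gamma_eqb (u v : word) : bool := `[< gamma_eq u v >].

Lemma gamma_eqb_equiv : equiv_class_of gamma_eqb.
Proof.
split=> [u|u v|v u w].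
- by apply/asboolP; exact: gamma_refl.
- by apply/asboolP/asboolP; exact: gamma_sym.
- by move=> /asboolP uv /asboolP vw; apply/asboolP; exact: gamma_trans uv vw.
Qed.

Canonical gamma_equiv_rel := EquivRelPack gamma_eqb_equiv.

Definition Gamma := {eq_quot gamma_eqb}%qT.
HB.instance Definition _ := Choice.on Gamma.
HB.instance Definition _ := EqQuotient.on Gamma.

Definition cls (w : word) : Gamma := \pi_Gamma%qT w.

Lemma clsP u v : cls u = cls v <-> gamma_eq u v.
Proof.
split; first by move=> /eqquotP /asboolP.
by move=> uv; apply/eqquotP/asboolP.
Qed.

Lemma clsK (g : Gamma) : cls (generic_quotient.repr g) = g.
Proof. exact: reprK. Qed.

Lemma gamma_repr u : gamma_eq (generic_quotient.repr (cls u)) u.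
Proof. by apply/clsP; rewrite clsK. Qed.

Lemma gamma_rev u v : gamma_eq u v -> gamma_eq (rev u) (rev v).
Proof.
elim=> {u v} [u|u v _ vu|v u w _ uv _ vw|u u' v v' _ uu _ vv|i|].
- exact: gamma_refl.
- exact: gamma_sym.
- exact: gamma_trans uv vw.
- by rewrite !rev_cat; apply: gamma_cat.
- exact: gamma_sqr.
- rewrite [rev _]/= /rev /=.
  have c1 := gamma_cat (gamma_cat (gamma_refl [:: i2]) gamma_02)
                       (gamma_refl [:: i2]).
  have c2 := gamma_cat (gamma_refl [:: i2; i0; i2; i0]) (gamma_sqr i2).
  apply: gamma_trans (gamma_sym c2) _.
  exact: gamma_trans c1 (gamma_sqr i2).
Qed.

Lemma gamma_revl u : gamma_eq (rev u ++ u) [::].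
Proof.
elim: u => [|i u IHu]; first exact: gamma_refl.
rewrite rev_cons -cats1 -catA -(cat1s i u) (catA [:: i]).
apply: gamma_trans IHu.
apply: gamma_cat (gamma_refl _) _.
exact: (gamma_cat (gamma_sqr i) (gamma_refl u)).
Qed.

Definition gamma_mul (g h : Gamma) := cls (generic_quotient.repr g ++ generic_quotient.repr h).
Definition gamma_inv (g : Gamma) := cls (rev (generic_quotient.repr g)).

Lemma gamma_mulE u v : gamma_mul (cls u) (cls v) = cls (u ++ v).
Proof. by apply/clsP/gamma_cat; exact: gamma_repr. Qed.

Lemma gamma_invE u : gamma_inv (cls u) = cls (rev u).
Proof. by apply/clsP/gamma_rev; exact: gamma_repr. Qed.

Lemma gamma_mulA : associative gamma_mul.
Proof.
move=> x y z; rewrite -(clsK x) -(clsK y) -(clsK z).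
by rewrite !gamma_mulE catA.
Qed.

Lemma gamma_mul1 : left_id (cls [::]) gamma_mul.
Proof. by move=> x; rewrite -(clsK x) gamma_mulE. Qed.

Lemma gamma_1mul : right_id (cls [::]) gamma_mul.
Proof. by move=> x; rewrite -(clsK x) gamma_mulE cats0. Qed.

Lemma gamma_mulV : left_inverse (cls [::]) gamma_inv gamma_mul.
Proof.
move=> x; rewrite -(clsK x) gamma_invE gamma_mulE.
by apply/clsP; exact: gamma_revl.
Qed.

Lemma gamma_Vmul : right_inverse (cls [::]) gamma_inv gamma_mul.
Proof.
move=> x; rewrite -(clsK x) gamma_invE gamma_mulE.
by apply/clsP; rewrite -{1}(revK (generic_quotient.repr x)); exact: gamma_revl.
Qed.

HB.instance Definition _ := isGroup.Build Gamma
  gamma_mulA gamma_mul1 gamma_1mul gamma_mulV gamma_Vmul.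

Definition R (i : 'I_3) : Gamma := cls [:: i].

Lemma cls1 : cls [::] = 1. Proof. by []. Qed.

Lemma clsM u v : cls (u ++ v) = cls u * cls v.
Proof. by rewrite -gamma_mulE. Qed.

Lemma R_sqr i : R i * R i = 1.
Proof. by rewrite -clsM; apply/clsP; exact: gamma_sqr. Qed.

Lemma R02_sqr : (R i0 * R i2) ^+ 2 = 1.
Proof. by rewrite expgS expg1 /R -!clsM; apply/clsP; exact: gamma_02. Qed.

Definition E : set Gamma := generated [set R i0; R i2].

(* von Dyck: s extends to Gamma as soon as it satisfies the relations; the value
   is meaningful only in that case. *)
Section Lift.
Variables (G : groupType) (s : 'I_3 -> G).

Definition lift (g : Gamma) : G := \prod_(i <- generic_quotient.repr g) s i.

Hypothesis s_sqr : forall i, s i * s i = 1.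
Hypothesis s_02 : (s i0 * s i2) ^+ 2 = 1.

Lemma lift_cls u : lift (cls u) = \prod_(i <- u) s i.
Proof.
rewrite /lift; have := gamma_repr u; move: (generic_quotient.repr _) => v.
elim=> {u v} [//|//|v u w _ -> _ -> //|u u' v v' _ uu _ vv|i|].
- by rewrite !big_cat uu vv.
- by rewrite !big_cons big_nil mulg1.
- by rewrite !big_cons big_nil mulg1 -[RHS]s_02 expgS expg1 !mulgA.
Qed.

Lemma liftM : {morph lift : x y / x * y}.
Proof.
by move=> x y; rewrite -(clsK x) -(clsK y) -clsM !lift_cls big_cat.
Qed.

Lemma lift_R i : lift (R i) = s i.
Proof. by rewrite lift_cls big_seq1. Qed.

End Lift.

(* s and P stand for the star and the superscript P in the name of a class. *)
Inductive edge_class : Set :=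
| T1
| T2 | T2s | T2P | T2ex | T2sex | T2Pex
| T3 | T4 | T4s | T4P | T5 | T5s | T5P.

(* The index 2 subgroup containing exactly the R_i with i \in c (see
   N2_unique), as a point stabiliser in degree 2. *)
Definition swap2 (c : {pred 'I_3}) (i : 'I_3) : 'S_2 :=
  if i \in c then 1 else tperm ord0 ord_max.

Definition N2 (c : {pred 'I_3}) : set Gamma :=
  [set g | lift (swap2 c) g ord0 = ord0].

(* The point k of {1,2,3,4} is the ordinal k - 1. *)
Definition pt (k : nat) : 'I_4 := inord k.-1.

Definition cyc (a b : nat) : 'S_4 := tperm (pt a) (pt b).

Definition act4 (p : 'S_4) (i : 'I_3) : 'S_4 :=
  if i == i0 then cyc 1 2 * cyc 3 4
  else if i == i2 then cyc 1 4 * cyc 2 3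
  else p.

(* The stabiliser of the point 1 in the degree 4 action with R_1 |-> p. *)
Definition N4 (p : 'S_4) : set Gamma :=
  [set g | lift (act4 p) g (pt 1) = pt 1].

Definition N (T : edge_class) : set Gamma :=
  match T with
  | T1 => setT
  | T2 => N2 [pred i in [:: i1; i2]]
  | T2s => N2 [pred i in [:: i0; i1]]
  | T2P => N2 [pred i in [:: i1]]
  | T2ex => N2 [pred i in [:: i2]]
  | T2sex => N2 [pred i in [:: i0]]
  | T2Pex => N2 pred0
  | T3 => N4 1
  | T4 => N4 (cyc 1 4)
  | T4s => N4 (cyc 1 2)
  | T4P => N4 (cyc 1 3)
  | T5 => N4 (cyc 1 4 * cyc 2 3)
  | T5s => N4 (cyc 1 2 * cyc 3 4)
  | T5P => N4 (cyc 1 3 * cyc 2 4)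
  end.

(* Connected maps, as transitive permutation generic_quotient.representations of Gamma. *)
Record Map := {
  flag : Type;
  act : flag -> Gamma -> flag;
  act1 : forall x, act x 1 = x;
  actM : forall x g h, act x (g * h) = act (act x g) h;
  flag_inhabited : inhabited flag;
  act_trans : forall x y, exists g, act x g = y }.

(* Aut M, the centraliser of Gamma in Sym (flag M); permutations are stored
   with their inverses. *)
Record Aut (M : Map) := {
  aut :> flag M -> flag M;
  aut_inv : flag M -> flag M;
  autK : cancel aut aut_inv;
  autKV : cancel aut_inv aut;
  aut_act : forall x g, aut (act x g) = act (aut x) g }.

Section AutGroup.
Variable M : Map.
Implicit Types f g : Aut M.

Lemma aut_ext f g : f =1 g -> f = g.
Proof.
case: f g => [f f' fK fK' fA] [g g' gK gK' gA] /= /funext fg.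
move: gK gK' gA; rewrite -{}fg => gK gK' gA.
have fg' : f' = g' by apply: funext => x; rewrite -{1}[x]gK' fK.
move: gK gK'; rewrite -{}fg' => gK gK'.
by congr Build_Aut; exact: Prop_irrelevance.
Qed.

Definition aut_one : Aut M :=
  @Build_Aut M id id (fun _ => erefl) (fun _ => erefl) (fun _ _ => erefl).

Lemma aut_mul_act f g x h : (f \o g) (act x h) = act ((f \o g) x) h.
Proof. by rewrite /= !aut_act. Qed.

Definition aut_mul f g : Aut M :=
  Build_Aut (can_comp (@autK _ f) (@autK _ g))
            (can_comp (@autKV _ g) (@autKV _ f)) (aut_mul_act f g).

Lemma aut_inv_act f x h : aut_inv f (act x h) = act (aut_inv f x) h.
Proof. by rewrite -{1}[x](autKV f) -aut_act autK. Qed.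

Definition aut_invg f : Aut M :=
  Build_Aut (@autKV _ f) (@autK _ f) (aut_inv_act f).

Lemma aut_mulA : associative aut_mul.
Proof. by move=> f g h; exact: aut_ext. Qed.

Lemma aut_mul1 : left_id aut_one aut_mul.
Proof. by move=> f; exact: aut_ext. Qed.

Lemma aut_1mul : right_id aut_one aut_mul.
Proof. by move=> f; exact: aut_ext. Qed.

Lemma aut_mulV : left_inverse aut_one aut_invg aut_mul.
Proof. by move=> f; apply: aut_ext => x; exact: autK. Qed.

Lemma aut_Vmul : right_inverse aut_one aut_invg aut_mul.
Proof. by move=> f; apply: aut_ext => x; exact: autKV. Qed.

HB.instance Definition _ := gen_eqMixin (Aut M).
HB.instance Definition _ := gen_choiceMixin (Aut M).
HB.instance Definition _ := isGroup.Build (Aut M)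
  aut_mulA aut_mul1 aut_1mul aut_mulV aut_Vmul.

End AutGroup.

Section MapNotions.
Variable M : Map.

Definition map_subgroup (x : flag M) : set Gamma := [set g | act x g = x].

Definition edge (x : flag M) : set (flag M) := [set act x e | e in E].

Definition edge_transitive :=
  forall x y : flag M, exists f : Aut M, f @` edge x = edge y.

Definition in_class (T : edge_class) :=
  edge_transitive /\
  forall x : flag M, conjugate (normaliser (map_subgroup x)) (N T).

Definition empty_boundary := forall (i : 'I_3) (x : flag M), act x (R i) <> x.

End MapNotions.

Lemma swap2_sqr c i : swap2 c i * swap2 c i = 1.
Proof. by rewrite /swap2; case: ifP => _; rewrite ?mulg1 ?tperm2. Qed.

Lemma swap2_02 c : (swap2 c i0 * swap2 c i2) ^+ 2 = 1.
Proof.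
rewrite /swap2 expgS expg1.
by do 2![case: ifP => _]; rewrite ?mul1g ?mulg1 ?tperm2 // ?mul1g.
Qed.


Lemma i3P (P : 'I_3 -> Prop) : P i0 -> P i1 -> P i2 -> forall i, P i.
Proof.
move=> P0 P1 P2 [[|[|[|//]]] lti].
- by have -> : Ordinal lti = i0 by exact: val_inj.
- by have -> : Ordinal lti = i1 by exact: val_inj.
- by have -> : Ordinal lti = i2 by exact: val_inj.
Qed.

Lemma gamma_ind (P : Gamma -> Prop) :
  P 1 -> (forall i g, P g -> P (R i * g)) -> forall g, P g.
Proof.
move=> P1 PM g; rewrite -(clsK g); elim: (generic_quotient.repr g) => [//|i u].
by rewrite -cat1s clsM; exact: PM.
Qed.

Lemma S2P (p : 'S_2) : p ord0 = ord0 <-> p = 1.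
Proof.
split=> [p0|->]; last by rewrite perm1.
apply/permP => -[[|[|//]] lti]; rewrite perm1.
- by have -> : Ordinal lti = ord0 by exact: val_inj.
- have -> : Ordinal lti = ord_max by exact: val_inj.
  have : p ord_max != ord0 by rewrite -[X in _ != X]p0 (inj_eq perm_inj).
  case: (p ord_max) => -[|[|//]] ltj // _; exact: val_inj.
Qed.

Lemma N2E c g : N2 c g <-> lift (swap2 c) g = 1.
Proof. exact: S2P. Qed.

Lemma N2_R c i : N2 c (R i) <-> i \in c.
Proof.
rewrite N2E lift_R; [|exact: swap2_sqr|exact: swap2_02].
rewrite /swap2; case: ifP => // _; split=> // /permP/(_ ord0).
by rewrite tpermL perm1.
Qed.

Lemma N2_subgroup c : is_subgroup (N2 c).
Proof.
have lM := liftM (swap2_sqr c) (swap2_02 c).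
split=> [|x y /N2E x1 /N2E y1]; apply/N2E.
  by rewrite -cls1 lift_cls ?big_nil//; [exact: swap2_sqr|exact: swap2_02].
have: lift (swap2 c) (x * y^-1 * y) = 1 by rewrite mulgVK.
by rewrite lM y1 mulg1.
Qed.

Lemma N2_index2 c g h : ~ N2 c g -> ~ N2 c h -> N2 c (g * h).
Proof.
rewrite /N2 /= (liftM (swap2_sqr c) (swap2_02 c)) permM.
move: (lift _ g) (lift _ h) => p q p0 q0.
have ord2 (k : 'I_2) : k <> ord0 -> k = ord_max.
  by case: k => -[|[|//]] ltk k0; [case: k0|]; exact: val_inj.
rewrite (ord2 _ p0); apply: contrapT => /ord2; rewrite -(ord2 _ q0).
by move=> /perm_inj.
Qed.

(* N2 c is the only subgroup of index at most 2 (that is, with the product of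
   any two non-members a member) containing R_i exactly for i \in c. *)
Lemma N2_unique c (H : set Gamma) :
  is_subgroup H -> (forall g h, ~ H g -> ~ H h -> H (g * h)) ->
  (forall i, H (R i) <-> i \in c) -> H = N2 c.
Proof.
have step (K : set Gamma) : is_subgroup K ->
    (forall g h, ~ K g -> ~ K h -> K (g * h)) ->
    forall x g, K (x * g) <-> (K x <-> K g).
  move=> [K1 KV] K2 x g.
  have Kinv y : K y -> K y^-1 by move=> Ky; rewrite -(mul1g y^-1); exact: KV.
  have KM y z : K y -> K z -> K (y * z).
    by move=> Ky Kz; rewrite -(invgK z); apply: KV => //; exact: Kinv.
  split=> [Kxg|Kxg].
    split=> [Kx|Kg]; last by rewrite -(mulgK g x); exact: KV.
    by rewrite -(mulKg x g); apply: KM => //; exact: Kinv.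
  have [Kx|nKx] := pselect (K x); first by apply: KM => //; exact/Kxg.
  by apply: K2 => // Kg; apply/nKx/Kxg.
move=> Hs H2 HR; apply/seteqP.
suff HN g : H g <-> N2 c g by split=> g /HN.
elim/gamma_ind: g => [|i g IHg]; first by split=> _; [case: (N2_subgroup c)|case: Hs].
rewrite (step _ Hs H2) (step _ (N2_subgroup c) (@N2_index2 c)).
by have := HR i; have := N2_R c i; tauto.
Qed.

Lemma pt_ord k (lt_k4 : (k < 4)%N) : pt k.+1 = Ordinal lt_k4.
Proof. by apply: val_inj; rewrite /= inordK. Qed.

Lemma act4_02 p : (act4 p i0 * act4 p i2) ^+ 2 = 1.
Proof.
apply/permP=> x; rewrite expgS expg1 /act4 /= /cyc.
rewrite (@pt_ord 0 isT) (@pt_ord 1 isT) (@pt_ord 2 isT) (@pt_ord 3 isT).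
by case: x => -[|[|[|[|//]]]] ltx; rewrite !permM !permE /=; exact: val_inj.
Qed.

Lemma act4_sqr p : p * p = 1 -> forall i, act4 p i * act4 p i = 1.
Proof.
move=> pp; elim/i3P; rewrite /act4 //=; apply/permP=> x; rewrite /cyc;
  rewrite (@pt_ord 0 isT) (@pt_ord 1 isT) (@pt_ord 2 isT) (@pt_ord 3 isT);
  by case: x => -[|[|[|[|//]]]] ltx; rewrite !permM !permE /=; exact: val_inj.
Qed.

Lemma N4_subgroup p : p * p = 1 -> is_subgroup (N4 p).
Proof.
move=> pp; have lM := liftM (act4_sqr pp) (act4_02 p).
split=> [|x y x1 y1]; rewrite /N4 /=.
  by rewrite -cls1 lift_cls ?big_nil ?perm1; [|exact: act4_sqr|exact: act4_02].
have: lift (act4 p) (x * y^-1 * y) (pt 1) = pt 1 by rewrite mulgVK.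
by rewrite lM permM -[X in _ = X]y1 => /perm_inj.
Qed.

Lemma N_subgroup T : is_subgroup (N T).
Proof.
case: T; rewrite /N; try exact: N2_subgroup; first (by split);
  apply: N4_subgroup; rewrite /cyc ?mulg1 ?tperm2 //;
  apply/permP=> x;
  rewrite ?(@pt_ord 0 isT) ?(@pt_ord 1 isT) ?(@pt_ord 2 isT) ?(@pt_ord 3 isT);
  by case: x => -[|[|[|[|//]]]] ltx; rewrite !permM !permE /=; exact: val_inj.
Qed.

(* Main.v *)
Require Import Defs.
From HB Require Import structures.
From mathcomp Require Import all_boot monoid perm.
From mathcomp Require Import boolp classical_sets.
From mathcomp Require Import ssralg ssrint zify.

(** Write N for [N T].  A map is determined by its map subgroup M; it lies in
    the class T when the normaliser of M is (conjugate to) N, since Gamma = NE; it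
    has empty boundary when M contains no conjugate of a generator R_i; and its
    automorphism group is then N / M.  So continuum many subgroups M with the
    first two properties are wanted, with pairwise non-isomorphic N / M.

    Normaliser and boundary are controlled by a finite permutation representation
    of Gamma, with a system of blocks permuted as the cosets of N are.  Let K be
    the pointwise stabiliser of the block 0, whose setwise stabiliser is N.  Then
    N normalises K.  If some w fixes the block 0 pointwise but moves a point of
    every other block, then nothing outside N normalises a subgroup of K
    containing w; and if each R_i moves a point of every block, then K contains no
    conjugate of R_i.  Suitable representations are listed in [table_of], and
    [table_ok] is the boolean test of their properties.

    The continuum comes from actions of Gamma on the integers: for n > 0 let R_0
    exchange n and -n, let R_2 be x |-> -x and R_1 be x |-> 1 - x.  As R_1 R_2 is
    a unit translation, the conjugate of R_0 by (R_1 R_2)^j exchanges two points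
    at distance 2n, and it fails to commute with R_0 only if the two pairs share
    exactly one point, that is, if j = 2n.  Hence the square [clash j] of the
    product of R_0 and that conjugate acts non-trivially only for n = j / 2.  For
    a set a of natural numbers, [map_group a] consists of the elements of K acting
    trivially on the lines with n = 24 (k + 1), for all k in a.  On the tables
    (R_1 R_2)^24 is trivial, hence so is [clash (48 (k + 1))], which therefore
    lies in [map_group a] if and only if k is not in a.  The elements w of the
    tables are products of conjugates of [clash j] with j < 48; they act trivially
    on all these lines, so they lie in every [map_group a], which therefore has
    the normaliser N.

    That enough of the quotients are non-isomorphic is a matter of counting.
    Since N is finitely generated ([stabiliser_determined]) and N / M countable,
    there are only countably many homomorphisms from N to N / M.  A subgroup M'
    with N / M' isomorphic to N / M is the kernel of one of them, so each
    isomorphism class occurs for countably many a ([iso_class_countable]).  A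
    diagonal argument in the manner of Koenig then finds continuum many classes
    ([countable_classes_transversal]). *)

Set Implicit Arguments.
Unset Strict Implicit.
Unset Printing Implicit Defensive.

Local Open Scope classical_set_scope.
Local Open Scope group_scope.

(** * Subgroups *)

Lemma subgroup1 (G : groupType) (H : set G) : is_subgroup H -> H 1.
Proof. by case. Qed.

Lemma subgroupV (G : groupType) (H : set G) :
  is_subgroup H -> forall x, H x -> H x^-1.
Proof. by move=> [H1 HV] x Hx; rewrite -(mul1g x^-1); exact: HV. Qed.

Lemma subgroupM (G : groupType) (H : set G) :
  is_subgroup H -> forall x y, H x -> H y -> H (x * y).
Proof.
move=> Hs x y Hx Hy; rewrite -(invgK y); apply: Hs.2 => //.
exact: subgroupV.
Qed.

Lemma generated_subgroup (G : groupType) (A : set G) :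
  is_subgroup (generated A).
Proof.
split=> [H [Hs _]|x y Ax Ay H [Hs HA]]; first exact: subgroup1 Hs.
by apply: Hs.2; [apply: Ax|apply: Ay].
Qed.

Lemma normaliserP (G : groupType) (H : set G) g :
  normaliser H g <-> forall h, H h <-> H (h ^ g).
Proof.
split=> [Hg h|Hg].
  split=> [Hh|]; first by rewrite -Hg; exists h.
  by rewrite -{1}Hg => -[k Hk /conjg_inj <-].
apply/seteqP; split=> [_ [h Hh <-]|h Hh]; first exact: (Hg h).1.
by exists (h ^ g^-1); [rewrite (Hg _)|]; rewrite conjgKV.
Qed.

Lemma cls_rev w : cls (rev w) = (cls w)^-1.
Proof. by rewrite -gamma_invE. Qed.

Lemma E_subgroup : is_subgroup E.
Proof. exact: generated_subgroup. Qed.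

Lemma cls_E w : all (predC1 i1) w -> E (cls w).
Proof.
have Es := E_subgroup.
elim: w => [_|i w IHw /= /andP[i_neq1 w_neq1]]; first exact: subgroup1 Es.
rewrite -cat1s clsM; apply: (subgroupM Es); last exact: IHw.
apply: sub_gen_smallest; move: i i_neq1.
by apply: i3P => // _; [left|right].
Qed.

(** * Permutation representations of Gamma *)

Section Words.
Variables (X : Type) (s : 'I_3 -> X -> X).

Definition wact (x : X) (w : word) : X := foldl (fun y i => s i y) x w.

Lemma wact_cat x u v : wact x (u ++ v) = wact (wact x u) v.
Proof. exact: foldl_cat. Qed.

End Words.

Record gset := GSet {
  point :> Type;
  gen : 'I_3 -> point -> point;
  gen_sqr : forall i x, wact gen x [:: i; i] = x;
  gen_02 : forall x, wact gen x [:: i0; i2; i0; i2] = x }.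

Section GammaSets.
Variable X : gset.
Implicit Types (x : X) (g h : Gamma).

Definition gact x g : X := wact (@gen X) x (generic_quotient.repr g).

Lemma gact_cls x w : gact x (cls w) = wact (@gen X) x w.
Proof.
rewrite /gact; have := gamma_repr w; move: (generic_quotient.repr _) => v vw.
elim: vw x => {v w}
  [//|u v _ IH x|u v w _ IHu _ IHv x|u u' v v' _ IHu _ IHv x|i x|x].
- by rewrite IH.
- by rewrite IHu.
- by rewrite !wact_cat IHu IHv.
- exact: gen_sqr.
- exact: gen_02.
Qed.

Lemma gact1 x : gact x 1 = x. Proof. exact: (gact_cls x [::]). Qed.

Lemma gactM x g h : gact x (g * h) = gact (gact x g) h.
Proof.
by rewrite -(clsK g) -(clsK h) -clsM !gact_cls wact_cat.
Qed.

Lemma gactK x g : gact (gact x g) g^-1 = x.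
Proof. by rewrite -gactM mulgV gact1. Qed.

Lemma gactKV x g : gact (gact x g^-1) g = x.
Proof. by rewrite -gactM mulVg gact1. Qed.

Lemma wact_revK x w : wact (@gen X) (wact (@gen X) x (rev w)) w = x.
Proof. by rewrite -!gact_cls cls_rev gactKV. Qed.

Definition trivial_at (x : X) : set Gamma := [set g | gact x g = x].

Lemma trivial_at_subgroup x : is_subgroup (trivial_at x).
Proof.
split=> [|g h gx hx]; first exact: gact1.
by rewrite /trivial_at /= gactM gx -{1}hx gactK.
Qed.

End GammaSets.

(** * The map with a given map subgroup *)

Section CosetMap.
Variable M : set Gamma.
Hypothesis subM : is_subgroup M.
Implicit Types g h : Gamma.

Definition rcoset g : set Gamma := [set h | M (h * g^-1)].

Lemma rcoset_eq g h : rcoset g = rcoset h <-> M (g * h^-1).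
Proof.
split=> [gh|Mgh].
  by rewrite -[M _]/(rcoset h g) -gh /rcoset /= mulgV; case: subM.
apply/seteqP; split=> k Mk; rewrite /rcoset /=.
  by rewrite -(mulgVK g k) -(mulgA _ g); apply: subgroupM.
have -> : k * g^-1 = k * h^-1 * (g * h^-1)^-1.
  by rewrite invgM invgK mulgA mulgVK.
exact: subM.2.
Qed.

Definition coset_flag := {A : set Gamma | exists g, A = rcoset g}.

Definition mk_coset g : coset_flag := exist _ (rcoset g) (ex_intro _ g erefl).

Lemma mk_surj (x : coset_flag) : exists g, x = mk_coset g.
Proof. by case: x => A [g Ag]; exists g; exact: eq_exist. Qed.

Lemma mk_eq g h : mk_coset g = mk_coset h <-> M (g * h^-1).
Proof.
rewrite -rcoset_eq; split=> [[]//|gh]; exact: eq_exist.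
Qed.

Definition coset_rep (x : coset_flag) : Gamma := projT1 (cid (mk_surj x)).

Lemma coset_repK x : mk_coset (coset_rep x) = x.
Proof. by rewrite /coset_rep; case: cid. Qed.

Lemma mk_rep_mul g h : mk_coset (coset_rep (mk_coset g) * h) = mk_coset (g * h).
Proof.
by apply/mk_eq; rewrite invgM mulgA mulgK; apply/mk_eq; rewrite coset_repK.
Qed.

Definition coset_act (x : coset_flag) h := mk_coset (coset_rep x * h).

Definition coset_map : Map.
Proof.
refine (@Build_Map coset_flag coset_act _ _ (inhabits (mk_coset 1)) _).
- by move=> x; rewrite /coset_act mulg1 coset_repK.
- by move=> x g h; rewrite /coset_act mk_rep_mul mulgA.
- move=> x y; exists ((coset_rep x)^-1 * coset_rep y).
  by rewrite /coset_act mulgA mulgV mul1g coset_repK.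
Defined.

Lemma act_mk g h : act (mk_coset g : flag coset_map) h = mk_coset (g * h).
Proof. exact: mk_rep_mul. Qed.

Lemma map_subgroup_mk g h :
  map_subgroup (mk_coset g : flag coset_map) h <-> M (h ^ g^-1).
Proof.
rewrite -[map_subgroup _ h]/(act (mk_coset g : flag coset_map) h = mk_coset g).
by rewrite act_mk mk_eq conjgE invgK !mulgA.
Qed.

(** Left multiplication by an element normalising [M] permutes the right cosets
    of [M] and commutes with right multiplication; this is the epimorphism from
    the normaliser onto the automorphism group, with kernel [M]. *)
Lemma coset_aut : exists F : Gamma -> Aut coset_map,
  forall n, normaliser M n ->
    (forall g, F n (mk_coset g) = mk_coset (n * g)) /\ (F n = 1 <-> M n).
Proof.
have ext n : normaliser M n ->
    exists f : Aut coset_map, forall g, f (mk_coset g) = mk_coset (n * g).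
  move=> /normaliserP nM.
  have eqn g h : mk_coset (n * g) = mk_coset (n * h) <->
      mk_coset g = mk_coset h.
    rewrite !mk_eq (nM (n * g * (n * h)^-1)) conjgE invgM.
    by rewrite !mulgA mulVg mul1g mulgVK.
  have eqnV g h : mk_coset (n^-1 * g) = mk_coset (n^-1 * h) <->
      mk_coset g = mk_coset h.
    by rewrite -eqn !mulVKg.
  have onmk m g :
      (forall h k, mk_coset (m * h) = mk_coset (m * k) <->
                   mk_coset h = mk_coset k) ->
      mk_coset (m * coset_rep (mk_coset g)) = mk_coset (m * g).
    by move=> eqm; apply/eqm; exact: coset_repK.
  unshelve eexists.
    refine (@Build_Aut coset_map (fun x => mk_coset (n * coset_rep x))
                                 (fun x => mk_coset (n^-1 * coset_rep x)) _ _ _).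
    - by move=> x; rewrite onmk// mulKg coset_repK.
    - by move=> x; rewrite onmk// mulVKg coset_repK.
    - move=> x h; have [g ->] := mk_surj x.
      by rewrite act_mk !onmk// act_mk mulgA.
  by move=> g /=; exact: onmk.
have exF n : exists f : Aut coset_map,
    normaliser M n -> forall g, f (mk_coset g) = mk_coset (n * g).
  by have [/ext[f fP]|] := pselect (normaliser M n); [exists f|exists 1].
have [F FP] := choice exF; exists F => n nM; split; first exact: FP.
split=> [Fn1|Mn].
  have := FP n nM 1; rewrite Fn1 /= => /esym/mk_eq.
  by rewrite invg1 !mulg1.
apply: aut_ext => x; have [g ->] := mk_surj x.
by rewrite FP //=; apply/mk_eq; rewrite mulgK.
Qed.

Lemma aut_eq (f h : Aut coset_map) : f (mk_coset 1) = h (mk_coset 1) -> f = h.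
Proof.
move=> fh; apply: aut_ext => x; have [g ->] := mk_surj x.
by rewrite -[g]mul1g -act_mk !aut_act fh.
Qed.

Lemma coset_map_empty_boundary :
  (forall i g, ~ M (R i ^ g)) -> empty_boundary coset_map.
Proof.
move=> MR i x; have [g ->] := mk_surj x => Rg.
by apply: (MR i g^-1); apply/map_subgroup_mk.
Qed.

Lemma coset_map_in_class T : normaliser M = N T ->
  (forall g, exists n e, [/\ N T n, E e & g = n * e]) ->
  in_class coset_map T.
Proof.
move=> nMN NE; split=> [x y|x].
  have [F FP] := coset_aut; have Es := E_subgroup.
  have [g ->] := mk_surj x; have [h ->] := mk_surj y.
  have [n1 [e1 [Nn1 Ee1 ->]]] := NE g; have [n2 [e2 [Nn2 Ee2 ->]]] := NE h.
  have := (N_subgroup T).2 _ _ Nn2 Nn1; rewrite -nMN => /FP[F12 _].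
  exists (F (n2 * n1^-1)).
  apply/seteqP; split=> [_ [_ [e Ee <-] <-]|_ [e Ee <-]].
    rewrite act_mk F12; exists (e2^-1 * (e1 * e)).
      by apply: (subgroupM Es); [exact: (subgroupV Es)|exact: (subgroupM Es)].
    by rewrite act_mk !mulgA mulgVK mulgK.
  exists (mk_coset (n1 * (e2 * e))); last first.
    by rewrite F12 act_mk !mulgA mulgVK.
  exists (e1^-1 * (e2 * e)); last by rewrite act_mk !mulgA mulgK.
  by apply: (subgroupM Es); [exact: (subgroupV Es)|exact: (subgroupM Es)].
have [g ->] := mk_surj x; exists g^-1; rewrite -nMN.
have conjN h : normaliser (map_subgroup (mk_coset g : flag coset_map)) h <->
    normaliser M (h ^ g^-1).
  split=> /normaliserP nh; apply/normaliserP => m.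
    by have := nh (m ^ g); rewrite !map_subgroup_mk conjgK (conjJg _ h) conjgK.
  by rewrite !map_subgroup_mk (conjJg _ h); exact: nh.
apply/seteqP; split=> [_ [h hN <-]|h hN]; first exact: (conjN h).1.
by exists (h ^ g); [apply/conjN|]; rewrite conjgK.
Qed.

End CosetMap.

(** * Continuum many isomorphism classes *)

(** Koenig: the continuum is not a countable union of smaller sets.  Split a
    sequence of bits into countably many sequences; if no fibre [c x = n]
    projected onto all sequences of bits at the n-th place, then the sequence
    whose n-th part is missed by the n-th fibre would lie in no fibre. *)
Lemma konig_continuum (c : (nat -> bool) -> nat) :
  exists (n : nat) (s : (nat -> bool) -> nat -> bool),
    injective s /\ forall x, c (s x) = n.
Proof.
pose proj (n : nat) (x : nat -> bool) (k : nat) := x (pickle (n, k)).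
have [n Pn] : exists n, forall y, exists x, c x = n /\ proj n x = y.
  apply: contrapT => /forallNP noP.
  have /choice[z zP] n : exists y, forall x, c x = n -> proj n x <> y.
    have /existsNP[y /forallNP yP] := noP n.
    by exists y => x cx px; apply: (yP x).
  (* the sequence whose n-th part is z n *)
  pose x p := if unpickle p is Some (n, k) then z n k else false.
  apply: (zP (c x) x) => //; apply: funext => k.
  by rewrite /proj /x pickleK.
have [s sP] := choice Pn; exists n, s.
split=> [x y sxy|x]; last by case: (sP x).
by have [_ <-] := sP x; have [_ <-] := sP y; rewrite sxy.
Qed.

(** Number the elements of each class injectively; then a continuum of elements
    with the same number meets each class at most once. *)
Lemma countable_classes_transversal
    (e : (nat -> bool) -> (nat -> bool) -> Prop) :
  (forall a, e a a) -> (forall a b, e a b -> e b a) ->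
  (forall a b c, e a b -> e b c -> e a c) ->
  (forall a, exists c : (nat -> bool) -> nat,
     forall b b', e b a -> e b' a -> c b = c b' -> b = b') ->
  exists s : (nat -> bool) -> nat -> bool,
    forall a b, a <> b -> ~ e (s a) (s b).
Proof.
move=> e_refl e_sym e_trans /choice[code codeP].
pose r a := xget (fun _ => false) [set b | e a b].
have er a : e a (r a) by exact: (@xgetI _ _ [set b | e a b] a (e_refl a)).
have r_eq a b : e a b -> r a = r b.
  move=> ab; suff eab : [set c | e a c] = [set c | e b c].
    by rewrite /r eab.
  apply/seteqP; split=> c /=; first exact/e_trans/e_sym.
  exact: e_trans.
have [n [s [s_inj sP]]] := konig_continuum (fun a => code (r a) a).
exists s => a b ab eab; apply/ab/s_inj/(codeP (r (s a))); first exact: er.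
  by rewrite (r_eq _ _ eab); exact: er.
by rewrite sP (r_eq _ _ eab) sP.
Qed.

Lemma isomorphic_refl (G : groupType) : isomorphic_groups G G.
Proof.
have idM : {morph @id G : x y / x * y} by [].
pose mx := isMultiplicative.Build G G id idM.
pose f : {multiplicative G -> G} := HB.pack id mx.
by exists f; exists id.
Qed.

Lemma isomorphic_sym (G H : groupType) :
  isomorphic_groups G H -> isomorphic_groups H G.
Proof.
move=> [f [g fK gK]].
have gM : {morph g : x y / x * y}.
  by move=> x y; apply: (can_inj fK); rewrite gmulfM !gK.
pose mx := isMultiplicative.Build H G g gM.
pose h : {multiplicative H -> G} := HB.pack g mx.
by exists h; exists f.
Qed.

Lemma isomorphic_trans (G H K : groupType) :
  isomorphic_groups G H -> isomorphic_groups H K -> isomorphic_groups G K.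
Proof.
move=> [f f_bij] [g g_bij].
have gfM : {morph g \o f : x y / x * y} by move=> x y /=; rewrite !gmulfM.
pose mx := isMultiplicative.Build G K (g \o f) gfM.
pose h : {multiplicative G -> K} := HB.pack (g \o f) mx.
by exists h; exact: bij_comp.
Qed.

Definition morphic_on (N : set Gamma) (G : groupType) (f : Gamma -> G) :=
  forall x y, N x -> N y -> f (x * y) = f x * f y.

(** The form in which the generation of the group [N] by the family [s] is used,
    and which spares the description of [N] by words in [s]. *)
Definition determined_by (I : Type) (s : I -> Gamma) (N : set Gamma) :=
  (forall i, N (s i)) /\
  forall (G : groupType) (f h : Gamma -> G), morphic_on N f -> morphic_on N h ->
    (forall i, f (s i) = h (s i)) -> forall g, N g -> f g = h g.

(** This is Schreier's lemma: a point stabiliser is generated by the elements closing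
    up, along the transversal [t], the edges of the orbit graph. *)
Lemma stabiliser_determined (X : gset) (O : finType) (p : O -> X) (o0 : O)
    (t : O -> Gamma) (nxt : O -> 'I_3 -> O) :
  t o0 = 1 -> (forall o, gact (p o0) (t o) = p o) ->
  (forall o i, gact (p o) (R i) = p (nxt o i)) ->
  injective p ->
  determined_by (fun oi : O * 'I_3 => t oi.1 * R oi.2 * (t (nxt oi.1 oi.2))^-1)
    (trivial_at (p o0)).
Proof.
move=> t1 tP nP p_inj; have Ns := trivial_at_subgroup (p o0).
have sN o i : trivial_at (p o0) (t o * R i * (t (nxt o i))^-1).
  by rewrite /trivial_at /= !gactM tP nP -tP gactK.
split=> [[o i]//|G f h fM hM fh g Ng].
have one (k : Gamma -> G) : morphic_on (trivial_at (p o0)) k -> k 1 = 1.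
  move=> kM; apply: (@mulgI _ (k 1)).
  by rewrite -kM ?mulg1//; exact: subgroup1 Ns.
suff main w : exists o, [/\ gact (p o0) (cls w) = p o &
    f (cls w * (t o)^-1) = h (cls w * (t o)^-1)].
  have [o []] := main (generic_quotient.repr g); rewrite clsK Ng => /p_inj <-.
  by rewrite t1 invg1 mulg1.
elim/last_ind: w => [|w i [o [wo fhw]]].
  by exists o0; rewrite t1 invg1 mulg1 one// one// gact1.
exists (nxt o i); rewrite -cats1 clsM; split; first by rewrite gactM wo nP.
have -> : cls w * cls [:: i] * (t (nxt o i))^-1 =
    (cls w * (t o)^-1) * (t o * R i * (t (nxt o i))^-1).
  by rewrite !mulgA mulgVK.
have Nw : trivial_at (p o0) (cls w * (t o)^-1).
  by rewrite /trivial_at /= gactM wo -tP gactK.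
by rewrite fM// hM// fhw (fh (o, i)).
Qed.

(** An automorphism is determined by the image of a single flag, and Gamma, hence
    the set of flags, is countable. *)
Lemma aut_code (M : set Gamma) (subM : is_subgroup M) :
  exists c : Aut (coset_map subM) -> nat, injective c.
Proof.
exists (fun f => pickle (generic_quotient.repr (coset_rep (f (mk_coset M 1))))).
move=> f h /(pcan_inj pickleK)/(congr1 cls); rewrite !clsK => fh.
by apply: aut_eq; rewrite -[LHS]coset_repK fh coset_repK.
Qed.

(** An isomorphism from the automorphism group of the map of [M b] onto that
    of [M a] turns the projection of [N] onto the former into a homomorphism to the
    latter with kernel [M b].  It is determined by its values on the finitely many
    generators [s], each in a countable group. *)
Lemma iso_class_countable (I : finType) (s : I -> Gamma) (N : set Gamma)
    (M : (nat -> bool) -> set Gamma) (subM : forall a, is_subgroup (M a)) :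
  is_subgroup N -> determined_by s N -> (forall a, normaliser (M a) = N) ->
  (forall a, M a `<=` N) -> injective M ->
  forall a, exists c : (nat -> bool) -> nat, forall b b',
    isomorphic_groups (Aut (coset_map (subM b))) (Aut (coset_map (subM a))) ->
    isomorphic_groups (Aut (coset_map (subM b'))) (Aut (coset_map (subM a))) ->
    c b = c b' -> b = b'.
Proof.
move=> Ns [sN sP] nM MN M_inj a; set A := Aut (coset_map (subM a)).
have [code code_inj] := aut_code (subM a).
have exh b : exists h : Gamma -> A,
    isomorphic_groups (Aut (coset_map (subM b))) A ->
    morphic_on N h /\ forall n, N n -> (h n = 1 <-> M b n).
  have [[f f_bij]|] := pselect (isomorphic_groups (Aut (coset_map (subM b))) A);
    last by exists (fun _ => 1).
  have [F FP] := coset_aut (subM b); rewrite nM in FP.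
  have FM : morphic_on N F.
    move=> x y Nx Ny; apply: aut_eq.
    have [Fx _] := FP _ Nx; have [Fy _] := FP _ Ny.
    have [-> _] := FP _ (subgroupM Ns Nx Ny).
    by rewrite -[RHS]/(F x (F y (mk_coset (M b) 1))) Fy Fx mulgA.
  have f1 : f 1 = 1 by apply: (@mulgI _ (f 1)); rewrite -gmulfM !mulg1.
  exists (f \o F) => _; split=> [x y Nx Ny /=|n Nn /=].
    by rewrite FM// gmulfM.
  have [_ <-] := FP _ Nn; split=> [|->//]; rewrite -{1}f1.
  exact: bij_inj.
have [h hP] := choice exh.
exists (fun b => pickle [ffun i => code (h b (s i))]) => b b'.
move=> /hP[hM hK] /hP[hM' hK'] /(pcan_inj pickleK)/ffunP eqh; apply: M_inj.
have {}eqh n : N n -> h b n = h b' n.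
  apply: sP => // i; apply: code_inj.
  by have := eqh i; rewrite !ffunE.
apply/seteqP; split=> n Mn; have Nn := MN _ _ Mn.
- by apply/(hK' _ Nn); rewrite -eqh//; apply/hK.
- by apply/(hK _ Nn); rewrite eqh//; apply/hK'.
Qed.

(** * Actions on the integers that separate elements of Gamma *)

(** A word for (R_1 R_2)^j; it translates the integers by -j. *)
Definition slide (j : nat) : word := flatten (nseq j [:: i1; i2]).

Definition conj_word (w v : word) : word := rev v ++ w ++ v.

(** It acts trivially wherever R_0 commutes with its conjugate by (R_1 R_2)^j. *)
Definition clash (j : nat) : word :=
  let v := i0 :: conj_word [:: i0] (slide j) in v ++ v.

Lemma wact_slideD (X : Type) (s : 'I_3 -> X -> X) x j k :
  wact s x (slide (j + k)) = wact s (wact s x (slide j)) (slide k).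
Proof. by rewrite /slide nseqD flatten_cat wact_cat. Qed.

Section Line.
Local Open Scope int_scope.
Variable n : nat.

Definition line_swap (x : int) : int :=
  if x == n%:Z then (- n%:Z)%R else if x == (- n%:Z)%R then n%:Z else x.

Definition line_gen (i : 'I_3) (x : int) : int :=
  if i == i0 then line_swap x else if i == i1 then (1 - x)%R else (- x)%R.

(** The case distinction in the form used by linear arithmetic. *)
Lemma line_swapP x : (x = n%:Z /\ line_swap x = (- n%:Z)%R) \/
  (x = (- n%:Z)%R /\ line_swap x = n%:Z) \/
  (x <> n%:Z /\ x <> (- n%:Z)%R /\ line_swap x = x).
Proof.
rewrite /line_swap; case: eqP => [->|xn]; first by left.
by case: eqP => [->|xNn]; right; [left|right].
Qed.

Lemma line_sqr i x : wact line_gen x [:: i; i] = x.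
Proof.
move: i; apply: i3P.
- rewrite -[LHS]/(line_swap (line_swap x)).
  have := line_swapP x; have := line_swapP (line_swap x); lia.
- by rewrite -[LHS]/(1 - (1 - x))%R; lia.
- by rewrite -[LHS]/(- - x)%R; lia.
Qed.

Lemma line_02 x : wact line_gen x [:: i0; i2; i0; i2] = x.
Proof.
rewrite -[LHS]/(- line_swap (- line_swap x))%R.
have := line_swapP x; have := line_swapP (- line_swap x)%R; lia.
Qed.

Definition line : gset := GSet line_sqr line_02.

Lemma line_slide j (x : line) : wact (@gen line) x (slide j) = (x - j%:Z)%R.
Proof.
elim: j x => [|j IH] x; first by rewrite /wact /=; lia.
by rewrite -addn1 wact_slideD IH -[LHS]/(- (1 - (x - j%:Z)))%R; lia.
Qed.

Lemma line_rev_slide j (x : line) :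
  wact (@gen line) x (rev (slide j)) = (x + j%:Z)%R.
Proof.
have := line_slide j (wact (@gen line) x (rev (slide j))).
by rewrite wact_revK; lia.
Qed.

Lemma line_clash j (x : line) : wact (@gen line) x (clash j) =
  let v y := (line_swap (line_swap y + j%:Z) - j%:Z)%R in v (v x).
Proof.
rewrite /clash /conj_word wact_cat.
have E y : wact (@gen line) y (i0 :: rev (slide j) ++ [:: i0] ++ slide j) =
    (line_swap (line_swap y + j%:Z) - j%:Z)%R.
  by rewrite -cat1s !wact_cat line_slide line_rev_slide.
by rewrite !E.
Qed.

(** The transpositions (-n n) and (-n-j n-j) are disjoint, hence commute, unless
    j = 0, when they coincide, or j = 2n. *)
Lemma line_clash_trivial (j : nat) (x : line) :
  j != n.*2 -> wact (@gen line) x (clash j) = x.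
Proof.
move/eqP=> jn; rewrite line_clash /=; set y := line_swap x.
set z := line_swap (y + j%:Z)%R; set u := line_swap (z - j%:Z)%R.
have := line_swapP x; have := line_swapP (y + j%:Z)%R.
have := line_swapP (z - j%:Z)%R; have := line_swapP (u + j%:Z)%R.
by rewrite -/y -/z -/u; lia.
Qed.

(** Two transpositions sharing exactly one point have a product of order 3. *)
Lemma line_clash_nontrivial : (0 < n)%N ->
  exists x : line, wact (@gen line) x (clash n.*2) <> x.
Proof.
move=> n_gt0; exists n%:Z; rewrite line_clash /=; set y := line_swap n%:Z.
set z := line_swap (y + n.*2%:Z)%R; set u := line_swap (z - n.*2%:Z)%R.
have := line_swapP n%:Z; have := line_swapP (y + n.*2%:Z)%R.
have := line_swapP (z - n.*2%:Z)%R; have := line_swapP (u + n.*2%:Z)%R.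
by rewrite -/y -/z -/u; lia.
Qed.

End Line.

(** * Finite imprimitive permutation representations *)

Definition cycles := seq (seq nat).

(** Permutations are written in cycle notation, and thus act on all natural
    numbers with finite support, which makes every table a representation on
    pairs of natural numbers without any bounds in the types. *)
Definition perm_of (cs : cycles) (x : nat) : nat :=
  foldl (fun y c => next c y) x cs.

(** The point x of the block b is the pair (b, x).  [nth [::] (blocks t) i] is the
    permutation of the blocks induced by R_i, and [fibres t] lists, for each i and
    each block b, the permutation x |-> x' such that R_i maps (b, x) to (b', x').
    [transversal t] contains words leading from the block 0 to each block, and
    [witness t] contains pairs (g, j) standing for the conjugate of [clash j] by
    g. *)
Record table := Table {
  blocks : seq cycles;
  fibres : seq (seq cycles);
  transversal : seq word;
  witness : seq (word * nat) }.

Definition block_gen (t : table) (i : 'I_3) (b : nat) : nat :=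
  perm_of (nth [::] (blocks t) i) b.

Definition fibre_gen (t : table) (i : 'I_3) (b x : nat) : nat :=
  perm_of (nth [::] (nth [::] (fibres t) i) b) x.

Definition table_gen (t : table) (i : 'I_3) (p : nat * nat) : nat * nat :=
  (block_gen t i p.1, fibre_gen t i p.1 p.2).

Definition witness_word (t : table) : word :=
  flatten [seq conj_word (clash gj.2) gj.1 | gj <- witness t].

Definition fixes_block (t : table) (w : word) (b : nat) : bool :=
  all (fun x => wact (table_gen t) (b, x) w == (b, x)) (iota 0 6).

Definition fixes_all (t : table) (w : word) : bool :=
  all (fixes_block t w) (iota 0 4).

Definition gens : seq 'I_3 := [:: i0; i1; i2].

(** The five groups of conditions: no block beyond the fourth is moved, nor is any
    point beyond the sixth moved within its block; the relations of Gamma and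
    (R_1 R_2)^24 = 1 hold; the words of the transversal are in R_0 and R_2 and lead
    to the right blocks; these blocks are permuted among themselves, each generator
    moving a point of each of them; the witness fixes the block 0 pointwise and
    moves a point of every other block. *)
Definition table_ok (t : table) : bool :=
  [&& [&& all (all (all (gtn 4))) (blocks t),
          all (fun f => size f <= 4) (fibres t)
        & all (all (all (all (gtn 6)))) (fibres t)],
      [&& all (fun i => fixes_all t [:: i; i]) gens,
          fixes_all t [:: i0; i2; i0; i2] & fixes_all t (slide 24)],
      [&& 0 < size (transversal t) <= 4, nth [::] (transversal t) 0 == [::],
          all (all (predC1 i1)) (transversal t) &
          all (fun b => wact (block_gen t) 0 (nth [::] (transversal t) b) == b)
            (iota 0 (size (transversal t)))],
      all (fun b => all (fun i => (block_gen t i b < size (transversal t)) &&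
          ~~ fixes_block t [:: i] b) gens)
        (iota 0 (size (transversal t)))
    & [&& all (fun gj => gj.2 < 48) (witness t),
          fixes_block t (witness_word t) 0 &
          all (fun b => ~~ fixes_block t (witness_word t) b)
            (iota 1 (size (transversal t)).-1)]].

Section Tables.
Variable t : table.
Hypothesis t_ok : table_ok t.

Lemma perm_of_large m cs x : all (all (gtn m)) cs -> m <= x -> perm_of cs x = x.
Proof.
move=> + mx; elim: cs => [//|c cs IHcs /= /andP[cm csm]] /=.
have cx : x \notin c by apply/negP => /(allP cm) /=; rewrite ltnNge mx.
by rewrite /perm_of /= next_nth ifN//; exact: IHcs.
Qed.

Lemma all_nth_nil (T : Type) (P : pred (seq T)) s i :
  all P s -> P [::] -> P (nth [::] s i).
Proof.
move=> sP P0; have [lt_is|] := ltnP i (size s); first exact/(all_nthP [::]).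
by move=> le_si; rewrite nth_default.
Qed.

Lemma block_gen_large i b : 4 <= b -> block_gen t i b = b.
Proof.
move=> b4; apply: (@perm_of_large 4) => //.
by case/and5P: t_ok => /and3P[bl4 _ _] _ _ _ _; exact: all_nth_nil.
Qed.

Lemma fibre_gen_large i b x : (4 <= b) || (6 <= x) -> fibre_gen t i b x = x.
Proof.
case/and5P: t_ok => /and3P[_ sf f6] _ _ _ _ /orP[b4|x6]; rewrite /fibre_gen.
  rewrite (@nth_default _ _ (nth [::] (fibres t) i))//.
  by apply: leq_trans b4; exact: (@all_nth_nil _ (fun f => size f <= 4)).
by apply: (@perm_of_large 6) => //; do 2!apply: all_nth_nil => //.
Qed.

Lemma wact_table_fst p w :
  (wact (table_gen t) p w).1 = wact (block_gen t) p.1 w.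
Proof. by elim: w p => [//|i w IHw] p; exact: (IHw (table_gen t i p)). Qed.

Lemma wact_table_large b x w :
  6 <= x -> wact (table_gen t) (b, x) w = (wact (block_gen t) b w, x).
Proof.
move=> x6; elim: w b => [//|i w IHw] b.
rewrite -[LHS]/(wact _ (table_gen t i (b, x)) w) /table_gen /=.
by rewrite fibre_gen_large ?x6 ?orbT ?IHw.
Qed.

(** A point outside the tested range moves with its block only, so it suffices
    that some tested point of the block returns to the block. *)
Lemma fixes_blockP w b :
  reflect (forall x, wact (table_gen t) (b, x) w = (b, x)) (fixes_block t w b).
Proof.
apply: (iffP allP) => [fix6 x|fixb x _]; last by rewrite fixb.
have [lt_x6|le_6x] := ltnP x 6; first by apply/eqP/fix6; rewrite mem_iota.
rewrite wact_table_large// -[b in LHS]/((b, 0).1) -wact_table_fst.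
by rewrite (eqP (fix6 0 _)).
Qed.

Lemma fixes_allP w :
  fixes_all t w -> forall p, wact (table_gen t) p w = p.
Proof.
move=> /allP fixw [b x]; have [lt_b4|le_4b] := ltnP b 4.
  by apply/fixes_blockP/fixw; rewrite mem_iota.
elim: w {fixw} => [//|i w IHw].
rewrite -[LHS]/(wact _ (table_gen t i (b, x)) w) /table_gen /=.
by rewrite block_gen_large// fibre_gen_large ?le_4b.
Qed.

Lemma table_sqr i p : wact (table_gen t) p [:: i; i] = p.
Proof.
apply: fixes_allP; case/and5P: t_ok => _ /and3P[/and4P[? ? ? _] _ _] _ _ _.
by move: i; apply: i3P.
Qed.

Lemma table_02 p : wact (table_gen t) p [:: i0; i2; i0; i2] = p.
Proof. by apply: fixes_allP; case/and5P: t_ok => _ /and3P[]. Qed.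

Definition table_set : gset := GSet table_sqr table_02.

Lemma block_sqr i b : wact (block_gen t) b [:: i; i] = b.
Proof. by rewrite -[b in LHS]/((b, 0).1) -wact_table_fst table_sqr. Qed.

Lemma block_02 b : wact (block_gen t) b [:: i0; i2; i0; i2] = b.
Proof. by rewrite -[b in LHS]/((b, 0).1) -wact_table_fst table_02. Qed.

Definition block_set : gset := GSet block_sqr block_02.

Lemma table_fst (p : table_set) g : (gact p g).1 = gact (p.1 : block_set) g.
Proof. by rewrite -(clsK g) !gact_cls; exact: wact_table_fst. Qed.

(** As (R_1 R_2)^j is trivial on the table, the conjugate of R_0 in [clash j] is R_0
    itself there. *)
Lemma table_clash j (p : table_set) :
  24 %| j -> wact (@gen table_set) p (clash j) = p.
Proof.
move=> /dvdnP[q ->].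
have slideP (x : table_set) : wact (@gen table_set) x (slide (q * 24)) = x.
  elim: q => [//|q IHq]; rewrite mulSn addnC wact_slideD IHq.
  by apply: fixes_allP; case/and5P: t_ok => _ /and3P[].
have revP (x : table_set) : wact (@gen table_set) x (rev (slide (q * 24))) = x.
  by rewrite -[LHS]slideP wact_revK.
have vP (x : table_set) : wact (@gen table_set) x
    (i0 :: conj_word [:: i0] (slide (q * 24))) = x.
  by rewrite -cat1s !wact_cat slideP revP -wact_cat; exact: table_sqr.
by rewrite wact_cat !vP.
Qed.

Definition block_count : nat := size (transversal t).

Definition trans (b : nat) : Gamma := cls (nth [::] (transversal t) b).

Lemma block_count_gt0 : 0 < block_count.
Proof. by case/and5P: t_ok => _ _ /and4P[/andP[]]. Qed.

Lemma trans0 : trans 0 = 1.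
Proof. by rewrite /trans; case/and5P: t_ok => _ _ /and4P[_ /eqP ->]. Qed.

Lemma trans_E b : b < block_count -> E (trans b).
Proof.
move=> b_lt; apply: cls_E; case/and5P: t_ok => _ _ /and4P[_ _ /allP trE _] _ _.
exact/trE/mem_nth.
Qed.

Lemma transP b : b < block_count -> gact (0 : block_set) (trans b) = b.
Proof.
move=> b_lt; rewrite gact_cls.
case/and5P: t_ok => _ _ /and4P[_ _ _ /allP trP] _ _.
by apply/eqP/trP; rewrite mem_iota.
Qed.

Lemma gens_all i : i \in gens.
Proof. by move: i; apply: i3P. Qed.

Lemma block_gen_lt i b : b < block_count -> block_gen t i b < block_count.
Proof.
move=> b_lt; case/and5P: t_ok => _ _ _ /allP/(_ b) + _.
by rewrite mem_iota => /(_ b_lt)/allP/(_ i (gens_all i))/andP[].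
Qed.

Lemma gact_block_lt (b : block_set) g :
  b < block_count -> gact b g < block_count.
Proof.
rewrite -(clsK g) gact_cls; elim: (generic_quotient.repr g) b => [//|i w IHw] b.
by move=> /(block_gen_lt i)/IHw.
Qed.

Lemma table_gen_moves i b : b < block_count ->
  exists x, wact (table_gen t) (b, x) [:: i] <> (b, x).
Proof.
move=> b_lt; case/and5P: t_ok => _ _ _ /allP/(_ b) + _.
rewrite mem_iota => /(_ b_lt)/allP/(_ i (gens_all i))/andP[_ nfix].
by apply: contrapT => /forallNP fixb; apply/(negP nfix)/fixes_blockP => x;
  exact: contrapT (fixb x).
Qed.

Lemma witness_lt gj : gj \in witness t -> gj.2 < 48.
Proof. by case/and5P: t_ok => _ _ _ _ /and3P[/allP + _ _]; exact. Qed.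

Lemma witness_fixes x : wact (table_gen t) (0, x) (witness_word t) = (0, x).
Proof. by apply/fixes_blockP; case/and5P: t_ok => _ _ _ _ /and3P[]. Qed.

Lemma witness_moves b : 0 < b < block_count ->
  exists x, wact (table_gen t) (b, x) (witness_word t) <> (b, x).
Proof.
move=> /andP[b_gt0 b_lt]; case/and5P: t_ok => _ _ _ _ /and3P[_ _ /allP/(_ b)].
rewrite mem_iota add1n prednK ?block_count_gt0// b_gt0 => /(_ b_lt) nfix.
by apply: contrapT => /forallNP fixb; apply/(negP nfix)/fixes_blockP => x;
  exact: contrapT (fixb x).
Qed.

End Tables.

(** * A table for each of the fourteen classes *)

Section Data.
Local Open Scope nat_scope.

(** In degree 2, [b0], [b1] and [b2] tell whether R_0, R_1 and R_2 exchange the two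
    blocks. *)
Definition table2 (b0 b1 b2 : bool) (f0 f1 f2 : seq cycles) ws : table :=
  let swap (b : bool) : cycles := if b then [:: [:: 0; 1]] else [::] in
  Table [:: swap b0; swap b1; swap b2] [:: f0; f1; f2]
    [:: [::]; [:: if b0 then i0 else i2]] ws.

(** In degree 4 the group E permutes the blocks regularly, so that the blocks can
    be identified in such a way that R_0 and R_2 act trivially within the fibres;
    the only relation left is then that R_1 be an involution. *)
Definition table4 (p1 : cycles) (f1 : seq cycles) ws : table :=
  Table [:: [:: [:: 0; 1]; [:: 2; 3]]; p1; [:: [:: 0; 3]; [:: 1; 2]]]
    [:: [::]; f1; [::]] [:: [::]; [:: i0]; [:: i0; i2]; [:: i2]] ws.

(** The permutations of the fibres were found by a computer search.  Fibres of at
    most six points leave enough freedom for a product of at most two conjugates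
    of words [clash j] to tell the kernel of the action on the block 0 from the
    kernels of the actions on the other blocks. *)
Definition table_of (T : edge_class) : table :=
  match T with
  | T1 => Table [:: [::]; [::]; [::]]
      [:: [:: [:: [:: 0; 1]]]; [:: [:: [:: 0; 1]]]; [:: [:: [:: 2; 3]]]]
      [:: [::]] [::]
  | T2 => table2 true false false
      [::]
      [:: [:: [:: 2; 3]]; [:: [:: 1; 2]]]
      [:: [:: [:: 0; 1]]; [:: [:: 0; 1]]]
      [:: ([::], 1); ([:: i1], 1)]
  | T2s => table2 false false true
      [:: [:: [:: 0; 1]]; [:: [:: 0; 1]]]
      [:: [:: [:: 1; 2]]; [:: [:: 0; 1]]]
      [::]
      [:: ([::], 1)]
  | T2P => table2 true false true
      [::]
      [:: [:: [:: 0; 2]]; [:: [:: 0; 1]]]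
      [:: [:: [:: 1; 3]]; [:: [:: 1; 3]]]
      [:: ([::], 1); ([:: i1], 1)]
  | T2ex => table2 true true false
      [::]
      [:: [:: [:: 0; 5]; [:: 1; 3; 4]]; [:: [:: 0; 5]; [:: 1; 4; 3]]]
      [:: [:: [:: 0; 1]; [:: 2; 3]]; [:: [:: 0; 1]; [:: 2; 3]]]
      [:: ([:: i1], 1); ([:: i1; i2], 1)]
  | T2sex => table2 false true true
      [:: [:: [:: 0; 3]; [:: 1; 2]]; [:: [:: 0; 3]; [:: 1; 2]]]
      [:: [:: [:: 0; 3; 2; 4]]; [:: [:: 0; 4; 2; 3]]]
      [::]
      [:: ([::], 1); ([::], 2)]
  | T2Pex => table2 true true true
      [::]
      [:: [:: [:: 0; 5; 1]; [:: 2; 3]]; [:: [:: 0; 1; 5]; [:: 2; 3]]]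
      [:: [:: [:: 0; 3]; [:: 1; 4]]; [:: [:: 0; 3]; [:: 1; 4]]]
      [:: ([::], 1); ([:: i1; i0; i2; i1], 1)]
  | T3 => table4 [::]
      [:: [:: [:: 0; 2]]; [:: [:: 0; 1]]; [:: [:: 2; 3]]; [:: [:: 0; 3]]]
      [:: ([::], 1); ([:: i1], 1)]
  | T4 => table4 [:: [:: 0; 3]]
      [:: [:: [:: 1; 3]]; [:: [:: 0; 1]; [:: 2; 3]];
          [:: [:: 2; 3]]; [:: [:: 1; 3]]]
      [:: ([::], 1); ([:: i1; i0], 1)]
  | T4s => table4 [:: [:: 0; 1]]
      [:: [:: [:: 0; 3; 2]]; [:: [:: 0; 2; 3]];
          [:: [:: 0; 1]; [:: 2; 3]]; [:: [:: 1; 2]]]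
      [:: ([::], 1); ([:: i1], 2)]
  | T4P => table4 [:: [:: 0; 2]]
      [:: [:: [:: 0; 2]]; [:: [:: 0; 1]]; [:: [:: 0; 2]]; [:: [:: 0; 2]]]
      [:: ([::], 2); ([:: i1; i0], 2)]
  | T5 => table4 [:: [:: 0; 3]; [:: 1; 2]]
      [:: [:: [:: 0; 2; 3; 1]]; [:: [:: 1; 3]; [:: 2; 4]];
          [:: [:: 1; 3]; [:: 2; 4]]; [:: [:: 0; 1; 3; 2]]]
      [:: ([:: i1; i2], 1); ([:: i1; i0; i1; i0], 1)]
  | T5s => table4 [:: [:: 0; 1]; [:: 2; 3]]
      [:: [:: [:: 0; 3; 1; 5; 2; 4]]; [:: [:: 0; 4; 2; 5; 1; 3]];
          [:: [:: 1; 5; 4]]; [:: [:: 1; 4; 5]]]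
      [:: ([::], 3); ([:: i1; i0; i1], 1)]
  | T5P => table4 [:: [:: 0; 2]; [:: 1; 3]]
      [:: [:: [:: 0; 2; 3; 4]]; [:: [:: 1; 4]; [:: 2; 3]];
          [:: [:: 0; 4; 3; 2]]; [:: [:: 1; 4]; [:: 2; 3]]]
      [:: ([::], 3); ([:: i1], 1)]
  end.

End Data.

Lemma table_of_ok T : table_ok (table_of T).
Proof. by case: T; vm_compute. Qed.

(** The relations needed for [Defs.lift] to be a morphism are inherited from the
    table. *)
Lemma lift_stabiliser n (q : 'I_3 -> 'S_n.+1)
    (t : table) (t_ok : table_ok t) g :
  (forall i x, q i x = block_gen t i x :> nat) ->
  Defs.lift q g ord0 = ord0 <-> trivial_at (0 : block_set t_ok) g.
Proof.
move=> qt.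
have q_sqr i : q i * q i = 1.
  apply/permP => x; rewrite permM perm1; apply: val_inj => /=.
  by rewrite !qt; exact: (block_sqr t_ok).
have q_02 : (q i0 * q i2) ^+ 2 = 1.
  apply/permP => x; rewrite expgS expg1 !permM perm1; apply: val_inj => /=.
  by rewrite !qt; exact: (block_02 t_ok).
have qg x : gact (nat_of_ord x : block_set t_ok) g = Defs.lift q g x :> nat.
  rewrite -(clsK g) (lift_cls q_sqr q_02) gact_cls.
  elim: (generic_quotient.repr g) x => [|i w IHw] x.
    by rewrite big_nil perm1.
  by rewrite big_cons permM -IHw qt.
have g0 : gact (0 : block_set t_ok) g = Defs.lift q g ord0 :> nat := qg ord0.
by rewrite /trivial_at /= g0; split=> [->//|lg0]; exact: val_inj.
Qed.

Lemma N_stabiliser T g :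
  N T g <-> trivial_at (0 : block_set (table_of_ok T)) g.
Proof.
have N2_stab c :
    (forall i x, swap2 c i x = block_gen (table_of T) i x :> nat) ->
    N2 c g <-> trivial_at (0 : block_set (table_of_ok T)) g.
  exact: lift_stabiliser.
have N4_stab p :
    (forall i x, act4 p i x = block_gen (table_of T) i x :> nat) ->
    N4 p g <-> trivial_at (0 : block_set (table_of_ok T)) g.
  have -> : N4 p = [set g | Defs.lift (act4 p) g ord0 = ord0].
    by rewrite /N4 (_ : pt 1 = ord0)// (@pt_ord 0 isT); exact: val_inj.
  exact: lift_stabiliser.
case: T N2_stab N4_stab => N2_stab N4_stab; rewrite /N.
- split=> // _; rewrite -(clsK g) /trivial_at /= gact_cls.
  elim: (generic_quotient.repr g) => [//|i w IHw].
  by move: i; apply: i3P.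
1-6: by apply: N2_stab; apply: i3P => x; rewrite /swap2 /=;
  case: x => -[|[|//]] x_lt; rewrite permE.
all: by apply: N4_stab; apply: i3P => x; rewrite /act4 /= /cyc
    ?(@pt_ord 0 isT) ?(@pt_ord 1 isT) ?(@pt_ord 2 isT) ?(@pt_ord 3 isT);
  case: x => -[|[|[|[|//]]]] x_lt; rewrite ?permM ?permE /= ?permE.
Qed.

(** * The map subgroups *)

Section MapSubgroups.
Variables (t : table) (t_ok : table_ok t).
Implicit Types (a : nat -> bool) (g : Gamma).

Local Notation blk := (block_set t_ok).
Local Notation tab := (table_set t_ok).

Definition fixes_line n : set Gamma :=
  [set g | forall x : line n, gact x g = x].

(** Multiples of 24, to fit the order of R_1 R_2 on the tables; positive, since R_0
    is trivial for n = 0. *)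
Definition width (k : nat) : nat := 24 * k.+1.

Definition map_group a : set Gamma :=
  [set g | (forall x, gact ((0%N, x) : tab) g = (0%N, x)) /\
           forall k, a k -> fixes_line (width k) g].

Lemma fixes_line_conj n g h : fixes_line n g -> fixes_line n (g ^ h).
Proof. by move=> ng x; rewrite conjgE !gactM ng gactKV. Qed.

Lemma map_group_subgroup a : is_subgroup (map_group a).
Proof.
have fixV (X : gset) (x : X) g h :
    gact x g = x -> gact x h = x -> gact x (g * h^-1) = x.
  exact: (trivial_at_subgroup x).2.
split=> [|g h [g0 ga] [h0 ha]].
  by split=> [x|k _ x]; rewrite gact1.
by split=> [x|k ak x]; apply: fixV => //; [exact: ga|exact: ha].
Qed.

Lemma map_group_stabiliser a g : map_group a g -> trivial_at (0%N : blk) g.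
Proof.
by move=> [/(_ 0%N) /(congr1 fst) g0 _]; rewrite table_fst in g0.
Qed.

Lemma stabiliser_normalises a n g :
  trivial_at (0%N : blk) n -> map_group a g -> map_group a (g ^ n).
Proof.
move=> Nn [g0 ga]; split=> [x|k /ga]; last exact: fixes_line_conj.
rewrite conjgE !gactM.
have : (gact ((0%N, x) : tab) n^-1).1 = 0%N.
  by rewrite table_fst /= -{1}Nn gactK.
case E : (gact _ n^-1) => [b y] /= b0.
by rewrite -b0 in g0; rewrite g0 -E gactKV.
Qed.

Lemma line_conj_word n u v :
  (forall x : line n, wact (@gen (line n)) x u = x) ->
  forall x : line n, wact (@gen (line n)) x (conj_word u v) = x.
Proof. by move=> uP x; rewrite /conj_word !wact_cat uP wact_revK. Qed.

(** The conjugates of [clash j] in the witness have j < 48, while the lines used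
    have 2n >= 48. *)
Lemma witness_map_group a : map_group a (cls (witness_word t)).
Proof.
split=> [x|k _ x]; rewrite gact_cls; first exact: witness_fixes.
have := @witness_lt _ t_ok; rewrite /witness_word.
elim: (witness t) x => [//|[v j] ws IHws] x ws_lt.
rewrite /= wact_cat IHws => [|gj gj_in]; last first.
  by apply: ws_lt; rewrite inE gj_in orbT.
apply: line_conj_word => y; apply: line_clash_trivial.
have /= := ws_lt (v, j); rewrite inE eqxx /width => /(_ isT); lia.
Qed.

(** If n moves the block 0 to another block b, then the conjugate of the witness by
    the inverse of n would fix the block 0 pointwise, so that the witness would fix
    b pointwise. *)
Lemma normaliser_map_group a :
  normaliser (map_group a) = trivial_at (0%N : blk).
Proof.
apply/seteqP; split=> n Nn.
  apply: contrapT => /= n0; set b := gact (0%N : blk) n in n0.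
  have b_lt : 0 < b < block_count t.
    rewrite lt0n; apply/andP; split; first by apply/eqP.
    exact/gact_block_lt/block_count_gt0.
  have [x] := witness_moves t_ok b_lt; apply.
  have [w0 _] : map_group a (cls (witness_word t) ^ n^-1).
    apply/((normaliserP _ _).1 Nn); rewrite conjgKV; exact: witness_map_group.
  have := gactKV ((b, x) : tab) n.
  have b0 : (gact ((b, x) : tab) n^-1).1 = 0%N by rewrite table_fst /= gactK.
  case E : (gact _ n^-1) b0 => [b' y] /= b0 Ey.
  have := w0 y; rewrite conjgE invgK !gactM -{1}b0 Ey gact_cls.
  move=> /(congr1 (fun p : tab => gact p n)); rewrite gactKV -b0 Ey; exact.
have NnV : trivial_at (0%N : blk) n^-1.
  exact/(subgroupV (trivial_at_subgroup (0%N : blk))).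
apply/normaliserP => g; split; first exact: stabiliser_normalises.
by move=> /(stabiliser_normalises NnV); rewrite conjgK.
Qed.

(** A conjugate of R_i fixing the block 0 pointwise would make R_i fix some block
    pointwise. *)
Lemma map_group_no_reflection a i g : ~ map_group a (R i ^ g).
Proof.
move=> [Rg _]; set b := gact (0%N : blk) g^-1.
have b_lt : b < block_count t by exact/gact_block_lt/block_count_gt0.
have [x] := table_gen_moves t_ok i b_lt; apply.
have b0 : (gact ((b, x) : tab) g).1 = 0%N by rewrite table_fst /= gactKV.
have Ex := gactK ((b, x) : tab) g.
case E : (gact _ g) b0 Ex => [b' y] /= -> Ex.
have := Rg y; rewrite conjgE !gactM Ex.
move=> /(congr1 (fun p : tab => gact p g^-1)).
by rewrite gactK Ex; have := gact_cls ((b, x) : tab) [:: i] => ->.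
Qed.

(** [clash (2 width k)] detects whether k belongs to the set. *)
Lemma map_group_inj : injective map_group.
Proof.
move=> a b ab; apply/funext => k.
have clashP c : map_group c (cls (clash (width k).*2)) <-> c k = false.
  split=> [[_ cP]|ck].
    apply/negP => /cP ck.
    have [|x] := @line_clash_nontrivial (width k); first by [].
    by apply; have := ck x; rewrite gact_cls.
  split=> [x|l cl x]; rewrite gact_cls.
    by apply: table_clash; rewrite /width; lia.
  apply: line_clash_trivial; apply/eqP => kl.
  by move: cl; rewrite (_ : l = k) ?ck//; move: kl; rewrite /width; lia.
case ak : (a k); case bk : (b k) => //.
- by have := (clashP b).2 bk; rewrite -ab => /clashP; rewrite ak.
- by have := (clashP a).2 ak; rewrite ab => /clashP; rewrite bk.
Qed.

End MapSubgroups.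

Theorem theorem1p6 (T : edge_class) :
  exists M : (nat -> bool) -> Map,
    (forall a, in_class (M a) T /\ empty_boundary (M a)) /\
    (forall a b, a <> b -> ~ isomorphic_groups (Aut (M a)) (Aut (M b))).
Proof.
set t_ok := table_of_ok T.
have NT : N T = trivial_at (0%N : block_set t_ok).
  by apply/seteqP; split=> g /N_stabiliser.
have subM a := map_group_subgroup t_ok a.
have blockP (g : Gamma) :
    gact (0%N : block_set t_ok) g < block_count (table_of T).
  exact/gact_block_lt/block_count_gt0.
have [I [s sP]] : exists (I : finType) (s : I -> Gamma), determined_by s (N T).
  rewrite NT; eexists; eexists.
  apply: (@stabiliser_determined (block_set t_ok) 'I_(block_count (table_of T))
    (fun b => nat_of_ord b) (Ordinal (block_count_gt0 t_ok))
    (fun b => trans (table_of T) b)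
    (fun b i => Ordinal (block_gen_lt t_ok i (ltn_ord b)))).
  - exact: trans0.
  - by move=> b; exact: transP.
  - by move=> b i; rewrite gact_cls.
  - exact: val_inj.
have nM a : normaliser (map_group t_ok a) = N T.
  by rewrite NT normaliser_map_group.
have MN a : map_group t_ok a `<=` N T.
  by rewrite NT => g; exact: map_group_stabiliser.
have [sel selP] := countable_classes_transversal
  (e := fun a b => isomorphic_groups (Aut (coset_map (subM a)))
                                     (Aut (coset_map (subM b))))
  (fun a => isomorphic_refl _) (fun a b => @isomorphic_sym _ _)
  (fun a b c => @isomorphic_trans _ _ _)
  (iso_class_countable subM (N_subgroup T) sP nM MN (@map_group_inj _ t_ok)).
exists (fun a => coset_map (subM (sel a))); split; last exact: selP.
move=> a; split.
  apply: coset_map_in_class => [|g]; first exact: nM.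
  set b := gact (0%N : block_set t_ok) g.
  exists (g * (trans (table_of T) b)^-1), (trans (table_of T) b).
  rewrite mulgVK; split=> //; last exact: (trans_E t_ok (blockP g)).
  have tb : gact (0%N : block_set t_ok) (trans (table_of T) b) = b.
    exact: (transP t_ok (blockP g)).
  by rewrite NT /trivial_at /= gactM -/b -{1}tb gactK.
apply: coset_map_empty_boundary => i g; exact: map_group_no_reflection.
Qed.
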